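(* Let $A\in\mathbb{R}^{d\times d}$ be symmetric positive definite, $b\in\mathbb{R}^d$, and $h>0$ such that the spectral radius of $I-\tfrac h2A$ is less than $1$. The MALA proposal for the target $N(A^{-1}b,A^{-1})$, $$y=(I-\tfrac h2A)x+\tfrac h2 b+\sqrt h\,\xi,\qquad \xi\sim N(0,I),$$ corresponds to the matrix splitting $\mathcal{A}=M-N$ with vector $\beta$ given by $$M=\tfrac2h(I-\tfrac h4A),\qquad \mathcal{A}=(I-\tfrac h4A)A,$$ $$N=\tfrac2h(I-\tfrac h4A)(I-\tfrac h2A),\qquad \beta=(I-\tfrac h4A)b .$$
   Context: $N(m,C)$ is the normal distribution with mean $m$ and covariance $C$. An AR(1) proposal $y=Gx+g+\nu$, $\nu\sim N(0,\Sigma)$, is said to correspond to the matrix splitting $\mathcal{A}=M-N$ with vector $\beta$ if $M$ is invertible, $G=M^{-1}N$, $g=M^{-1}\beta$ and $\Sigma=M^{-1}(M^T+N)M^{-T}$; equivalently, $y$ is given by $My=Nx+\beta+\nu'$ with $\nu'\sim N(0,M^T+N)$. *)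

(* Defs.v *)
From HB Require Import structures.
From mathcomp Require Import all_boot all_order all_algebra.
From mathcomp Require Import all_classical all_reals all_analysis.
From mathcomp Require Import complex.

Set Implicit Arguments.
Unset Strict Implicit.
Unset Printing Implicit Defensive.

Import Order.TTheory GRing.Theory Num.Theory.

Local Open Scope classical_set_scope.
Local Open Scope ring_scope.

(* A 1 x 1 matrix product, read as a scalar. *)
Definition dotp (R : realType) (n : nat) (t x : 'cV[R]_n) : R :=
  (t^T *m x) 0 0.

Definition posdefmx (R : realType) (n : nat) (A : 'M[R]_n) : Prop :=
  A^T = A /\ forall x : 'cV[R]_n, x != 0 -> 0 < dotp x (A *m x).

(* The eigenvalues of a real matrix are taken in the complex numbers R[i];
   for n = 0 there are none and the spectral radius is sup set0 = 0. *)
Definition spectral_radius (R : realType) (n : nat) (B : 'M[R]_n) : R :=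
  sup [set complex.Re `|z| | z in
        [set z : R[i] | eigenvalue (map_mx (real_complex R) B) z]].

(* [normal_prob m s] takes the standard deviation s, and for s = 0 it is the
   uniform law on [0, 1]; the degenerate law N(m, 0) must be the Dirac mass. *)
Definition normal_law (R : realType) (m v : R) (B : set R) : \bar R :=
  if v == 0 then dirac m B else normal_prob m (Num.sqrt v) B.

(* X ~ N(m, C): C is a covariance matrix (symmetric, positive semidefinite,
   possibly singular) and every linear combination t^T X of the components of
   X has the univariate normal law N(t^T m, t^T C t). *)
Definition is_normal (R : realType) (d : measure_display)
    (Omega : measurableType d) (P : probability Omega R) (n : nat)
    (X : Omega -> 'cV[R]_n) (m : 'cV[R]_n) (C : 'M[R]_n) : Prop :=
  [/\ C^T = C,
      forall t : 'cV[R]_n, 0 <= dotp t (C *m t),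
      forall i : 'I_n, measurable_fun setT (fun w => X w i 0) &
      forall (t : 'cV[R]_n) (B : set R), measurable B ->
        pushforward P (fun w => dotp t (X w)) B
          = normal_law (dotp t m) (dotp t (C *m t)) B].

(* A proposal y maps the current state x to a random vector y x; it is AR(1)
   when y x = G x + g + nu with noise nu ~ N(0, Sigma) not depending on x. *)
Definition ar1_proposal (R : realType) (d : measure_display)
    (Omega : measurableType d) (P : probability Omega R) (n : nat)
    (y : 'cV[R]_n -> Omega -> 'cV[R]_n)
    (G : 'M[R]_n) (g : 'cV[R]_n) (Sigma : 'M[R]_n) : Prop :=
  exists nu : Omega -> 'cV[R]_n,
    is_normal P nu 0 Sigma /\
    forall x w, y x w = G *m x + g + nu w.

(* G, g and Sigma are determined by the proposal y, so quantifying them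
   existentially is no loss. *)
Definition corresponds_to_splitting (R : realType) (d : measure_display)
    (Omega : measurableType d) (P : probability Omega R) (n : nat)
    (y : 'cV[R]_n -> Omega -> 'cV[R]_n)
    (cA M N : 'M[R]_n) (beta : 'cV[R]_n) : Prop :=
  exists (G : 'M[R]_n) (g : 'cV[R]_n) (Sigma : 'M[R]_n),
    ar1_proposal P y G g Sigma /\
    [/\ cA = M - N,
        M \in unitmx,
        G = invmx M *m N,
        g = invmx M *m beta &
        Sigma = invmx M *m (M^T + N) *m (invmx M)^T].

(* The MALA proposal for the target N(A^-1 b, A^-1), driven by xi. *)
Definition mala_proposal (R : realType) (Omega : Type) (n : nat)
    (A : 'M[R]_n) (b : 'cV[R]_n) (h : R) (xi : Omega -> 'cV[R]_n)
    (x : 'cV[R]_n) (w : Omega) : 'cV[R]_n :=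
  (1%:M - (h / 2) *: A) *m x + (h / 2) *: b + Num.sqrt h *: xi w.

(* Main.v *)
Require Import Defs.
From HB Require Import structures.
From mathcomp Require Import all_boot all_order all_algebra.
From mathcomp Require Import all_classical all_reals all_analysis.
From mathcomp Require Import complex measurable_realfun ring.

Import Order.TTheory GRing.Theory Num.Theory.

Local Open Scope classical_set_scope.
Local Open Scope ring_scope.

(** Write K = I - (h/4) A and S = I - (h/2) A, so that I + S = 2 K and
    I - S = (h/2) A.  With M = (2/h) K and N = M S, everything except the
    invertibility of K is algebra: M - N = M (I - S) = K A, M^-1 N = S,
    M^-1 beta = (h/2) b, and, K being symmetric,
    M^T + N = M (I + S) = 2 M K = h M M^T, whence
    M^-1 (M^T + N) M^-T = h I, which is the covariance of sqrt(h) xi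
    ([is_normal_scale]).

    The spectral condition is what makes K invertible: since 2 K = I + S,
    a singular K would give S the eigenvalue -1, hence a spectral radius of at
    least 1 ([unitmx_of_spectral_radius_lt1]). *)

(** The supremum defining the spectral radius is a genuine upper bound because
    the eigenvalues are roots of the characteristic polynomial, which splits
    over the complex numbers: the sum of the moduli of all its roots bounds
    each of them. *)
Lemma eigenvalue_le_spectral_radius (R : realType) (n : nat) (B : 'M[R]_n)
    (z : R[i]) :
  eigenvalue (map_mx (real_complex R) B) z ->
  complex.Re `|z| <= spectral_radius B.
Proof.
move=> Bz; apply: ub_le_sup; last by exists z.
set p := char_poly (map_mx (real_complex R) B).
have [r def_p] := closed_field_poly_normal p.
have Re_ge0 (u : R[i]) : 0 <= complex.Re `|u|.
  by case: u => a c; rewrite normc_def /= sqrtr_ge0.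
exists (\sum_(u <- r) complex.Re `|u|) => _ [u /= Bu <-].
have ur : u \in r.
  move: Bu; rewrite eigenvalue_root_char -/p def_p rootZ ?root_prod_XsubC //.
  by rewrite (monicP (char_poly_monic _)) oner_neq0.
rewrite (big_rem u ur) /= lerDl; apply: sumr_ge0 => v _; exact: Re_ge0.
Qed.

(** A nonzero v with v (I + S) = 0 is an eigenvector of S for -1, which has
    modulus 1. *)
Lemma unitmx_of_spectral_radius_lt1 (R : realType) (n : nat) (S : 'M[R]_n) :
  spectral_radius S < 1 -> 1%:M + S \in unitmx.
Proof.
apply: contraTT; rewrite unitmxE unitfE negbK -leNgt => /det0P[v v0 vS].
have -> : 1 = complex.Re `|-1 : R[i]| by rewrite normrN1.
apply: eigenvalue_le_spectral_radius.
apply/eigenvalueP; exists (map_mx (real_complex R) v); last first.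
  by rewrite map_mx_eq0.
move: vS; rewrite mulmxDr mulmx1 => /eqP; rewrite addrC addr_eq0 => /eqP vS.
by rewrite -map_mxM vS map_mxN scaleN1r.
Qed.

Lemma is_normal_scale (R : realType) (d : measure_display)
    (Omega : measurableType d) (P : probability Omega R) (n : nat)
    (X : Omega -> 'cV[R]_n) (m : 'cV[R]_n) (C : 'M[R]_n) (c : R) :
  is_normal P X m C ->
  is_normal P (fun w => c *: X w) (c *: m) (c ^+ 2 *: C).
Proof.
case=> Csym Cpos Xmeas Xlaw.
have dotpZr t x : dotp t (c *: x) = dotp (c *: t) x.
  by rewrite /dotp [(c *: t)^T]linearZ /= -scalemxAr -scalemxAl.
have dotpC t : dotp t (c ^+ 2 *: C *m t) = dotp (c *: t) (C *m (c *: t)).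
  by rewrite -dotpZr -scalemxAr -scalemxAl scalerA expr2.
split.
- by rewrite linearZ /= Csym.
- by move=> t; rewrite dotpC.
- move=> i; apply: (eq_measurable_fun (fun w => c * X w i 0)) => [w _|].
    by rewrite mxE.
  exact: measurable_funM.
(* A linear form t applied to c X is the linear form c t applied to X. *)
- move=> t B mB; rewrite dotpC dotpZr -Xlaw //.
  by congr (pushforward P _ B); apply/funext => w; rewrite dotpZr.
Qed.

Theorem theorem5p1 (R : realType) (n : nat) (A : 'M[R]_n) (b : 'cV[R]_n)
    (h : R)
    (hA : posdefmx A) (hh : 0 < h)
    (hrho : spectral_radius (1%:M - (h / 2) *: A) < 1)
    (disp : measure_display) (Omega : measurableType disp)
    (P : probability Omega R) (xi : Omega -> 'cV[R]_n)
    (hxi : is_normal P xi 0 1%:M) :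
  corresponds_to_splitting P (mala_proposal A b h xi)
    ((1%:M - (h / 4) *: A) *m A)
    ((2 / h) *: (1%:M - (h / 4) *: A))
    ((2 / h) *: ((1%:M - (h / 4) *: A) *m (1%:M - (h / 2) *: A)))
    ((1%:M - (h / 4) *: A) *m b).
Proof.
have h0 : h != 0 by rewrite gt_eqF.
set S := 1%:M - (h / 2) *: A in hrho *; set K := 1%:M - (h / 4) *: A.
have K2 : 1%:M + S = 2 *: K.
  by apply/matrixP => i j; rewrite !mxE; field.
have KT : K^T = K.
  by case: hA => AT _; rewrite /K linearB /= linearZ /= trmx1 AT.
set M := (2 / h) *: K.
have Mu : M \in unitmx.
  have -> : M = h^-1 *: (1%:M + S) by rewrite K2 scalerA mulrC.
  by rewrite unitmxZ ?unitfE ?invr_eq0 // unitmx_of_spectral_radius_lt1.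
have MT : M^T = M by rewrite /M linearZ /= KT.
have hM : h *: M = 2 *: K by rewrite scalerA mulrCA divff // mulr1.
have KE : K = (h / 2) *: M.
  by rewrite mulrC -scalerA hM scalerA mulVf // scale1r.
have NE : (2 / h) *: (K *m S) = M *m S by rewrite scalemxAl.
exists S, ((h / 2) *: b), (h *: 1%:M); split.
  exists (fun w => Num.sqrt h *: xi w); split; last by move=> x w.
  have hnu := @is_normal_scale _ _ _ _ _ _ _ _ (Num.sqrt h) hxi.
  by rewrite scaler0 (sqr_sqrtr (ltW hh)) in hnu.
rewrite NE; split; last 1 first.
- rewrite trmx_inv MT -{2}(mulmx1 M) -mulmxDr K2 -hM mulKmx //.
  by rewrite -scalemxAl mulmxV.
- rewrite -{1}(mulmx1 M) -mulmxBr opprB addrC subrK -scalemxAr KE.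
  by rewrite scalemxAl.
- exact: Mu.
- by rewrite mulKmx.
- by rewrite KE -scalemxAl -scalemxAr mulKmx.
Qed.
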